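(* Let $m$ be an odd positive integer and $F_m$ the $m$-th Fibonacci polynomial. 1. If $m\equiv 1$ or $2 \pmod 3$, then $F_m$ has a fixed point $a$ in $\mathbb{Z}_2$, and the minimal decomposition of $\mathbb{Z}_2$ for $F_m$ is $\mathbb{Z}_2=\{a\}\sqcup(\mathbb{Z}_2-\{a\})$, where $\mathbb{Z}_2-\{a\}$ is the attracting basin of $\{a\}$. 2. If $m\equiv 0 \pmod 3$, then $F_m$ has a cycle $\{a,b\}$ of length 2 in $\mathbb{Z}_2$, and the minimal decomposition of $\mathbb{Z}_2$ for $F_m$ is $\mathbb{Z}_2=\{a,b\}\sqcup(\mathbb{Z}_2-\{a,b\})$, where $\{a,b\}$ is a cycle of period 2 and $\mathbb{Z}_2-\{a,b\}$ is the attracting basin of $\{a,b\}$.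
   Context: $\mathbb{Z}_2$ is the ring of 2-adic integers with the 2-adic metric. The Fibonacci polynomials are defined by $F_0(x)=0$, $F_1(x)=1$, $F_m(x)=xF_{m-1}(x)+F_{m-2}(x)$ for $m\ge 2$. For a polynomial $f$ over $\mathbb{Z}_2$, a minimal decomposition of $\mathbb{Z}_2$ for $f$ is a decomposition $\mathbb{Z}_2=\mathcal P\sqcup\mathcal M\sqcup\mathcal B$ (some parts possibly empty) in which: $\mathcal P$ is the finite set consisting of all periodic points of $f$; $\mathcal M=\bigsqcup_i\mathcal M_i$ is the union of all (at most countably many) clopen $f$-invariant sets $\mathcal M_i$ (the minimal components), each a finite union of balls, such that each $f:\mathcal M_i\to\mathcal M_i$ is minimal (every orbit is dense in $\mathcal M_i$); and each point of $\mathcal B$ lies in the attracting basin of a periodic orbit or of a minimal subsystem. A point $x$ lies in the attracting basin of a set $C$ (a periodic orbit or minimal component) if the distance from $f^n(x)$ to $C$ tends to $0$ as $n\to\infty$; when a part $\mathcal B$ of a decomposition is said to be the attracting basin of $C$, this means every point of $\mathcal B$ lies in the attracting basin of $C$ (the points of $C$ being listed separately). *)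

(* Defs.v *)
From Stdlib Require Import Rdefinitions.
From HB Require Import structures.
From mathcomp Require Import all_boot all_order all_algebra.
From mathcomp Require Import all_classical all_reals all_analysis.
From mathcomp Require Import Rstruct.

Set Implicit Arguments.
Unset Strict Implicit.
Unset Printing Implicit Defensive.

Import Order.TTheory GRing.Theory Num.Theory.

Local Open Scope classical_set_scope.
Local Open Scope ring_scope.

(* The ring of 2-adic integers is the inverse limit of the rings Z/2^(n+1):
   [x n] is the residue of [x] modulo 2^(n+1).  The shift avoids the zero
   ring, which ['Z_1] does not represent. *)
Definition coherent (x : forall n, 'Z_(2 ^ n.+1)) : bool :=
  `[< forall n, x n = (x n.+1 : nat)%:R >].

Record Z2 := MkZ2 { residue :> forall n, 'Z_(2 ^ n.+1); _ : coherent residue }.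

HB.instance Definition _ := [isSub for residue].
HB.instance Definition _ := [Choice of Z2 by <:].

Lemma Z2P (x y : Z2) : (forall n, x n = y n) -> x = y.
Proof.
move=> xy; apply: val_inj; apply: functional_extensionality_dep => n.
exact: xy.
Qed.

Lemma residueE (x : Z2) n : x n = (x n.+1 : nat)%:R.
Proof. by case: x => x /= /asboolP x_coh; apply: x_coh. Qed.

Lemma gt1_exp2S n : (1 < 2 ^ n.+1)%N.
Proof. by rewrite -{1}(expn0 2) ltn_exp2l. Qed.

Lemma natr_modZ n k : (k %% 2 ^ n.+2)%:R = k%:R :> 'Z_(2 ^ n.+1).
Proof.
rewrite -(Zp_nat_mod (gt1_exp2S n)) modn_dvdm ?Zp_nat_mod ?gt1_exp2S //.
by rewrite dvdn_exp2l.
Qed.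

Lemma redD n (a b : 'Z_(2 ^ n.+2)) :
  ((a + b)%R : nat)%:R = (a : nat)%:R + (b : nat)%:R :> 'Z_(2 ^ n.+1).
Proof.
rewrite /= [X in (_ %% X)%N](Zp_cast (gt1_exp2S n.+1)) natr_modZ.
by rewrite natrD.
Qed.

Lemma redM n (a b : 'Z_(2 ^ n.+2)) :
  ((a * b)%R : nat)%:R = (a : nat)%:R * (b : nat)%:R :> 'Z_(2 ^ n.+1).
Proof.
rewrite /= [X in (_ %% X)%N](Zp_cast (gt1_exp2S n.+1)) natr_modZ.
by rewrite natrM.
Qed.

Lemma redN n (a : 'Z_(2 ^ n.+2)) :
  ((- a)%R : nat)%:R = - (a : nat)%:R :> 'Z_(2 ^ n.+1).
Proof. by apply/eqP; rewrite eq_sym -subr_eq0 -opprD oppr_eq0 -redD subrr. Qed.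

Lemma coherent0 : coherent (fun=> 0). Proof. exact/asboolP. Qed.

Lemma coherent1 : coherent (fun=> 1).
Proof. exact/asboolP. Qed.

Lemma coherentN (x : Z2) : coherent (fun n => - x n).
Proof. by apply/asboolP => n; rewrite redN -residueE. Qed.

Lemma coherentD (x y : Z2) : coherent (fun n => x n + y n).
Proof. by apply/asboolP => n; rewrite redD -!residueE. Qed.

Lemma coherentM (x y : Z2) : coherent (fun n => x n * y n).
Proof. by apply/asboolP => n; rewrite redM -!residueE. Qed.

Definition Z2_zero : Z2 := MkZ2 coherent0.
Definition Z2_one : Z2 := MkZ2 coherent1.
Definition Z2_opp (x : Z2) : Z2 := MkZ2 (coherentN x).
Definition Z2_add (x y : Z2) : Z2 := MkZ2 (coherentD x y).
Definition Z2_mul (x y : Z2) : Z2 := MkZ2 (coherentM x y).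

Fact Z2_addA : associative Z2_add.
Proof. by move=> x y z; apply: Z2P => n /=; rewrite addrA. Qed.
Fact Z2_addC : commutative Z2_add.
Proof. by move=> x y; apply: Z2P => n /=; rewrite addrC. Qed.
Fact Z2_add0 : left_id Z2_zero Z2_add.
Proof. by move=> x; apply: Z2P => n /=; rewrite add0r. Qed.
Fact Z2_addN : left_inverse Z2_zero Z2_opp Z2_add.
Proof. by move=> x; apply: Z2P => n /=; rewrite addNr. Qed.

HB.instance Definition _ :=
  GRing.isZmodule.Build Z2 Z2_addA Z2_addC Z2_add0 Z2_addN.

Fact Z2_mulA : associative Z2_mul.
Proof. by move=> x y z; apply: Z2P => n /=; rewrite mulrA. Qed.
Fact Z2_mulC : commutative Z2_mul.
Proof. by move=> x y; apply: Z2P => n /=; rewrite mulrC. Qed.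
Fact Z2_mul1 : left_id Z2_one Z2_mul.
Proof. by move=> x; apply: Z2P => n /=; rewrite mul1r. Qed.
Fact Z2_mulD : left_distributive Z2_mul Z2_add.
Proof. by move=> x y z; apply: Z2P => n /=; rewrite mulrDl. Qed.
Fact Z2_one_neq0 : Z2_one != 0.
Proof. by apply/eqP => /(congr1 (residue^~ 0)). Qed.

HB.instance Definition _ := GRing.Zmodule_isComNzRing.Build Z2
  Z2_mulA Z2_mulC Z2_mul1 Z2_mulD Z2_one_neq0.

(* The 2-adic absolute value: if [x != 0], the least [n] with [x n != 0] is
   the exponent of the largest power of 2 dividing [x]. *)
Definition Z2_abs (x : Z2) : R :=
  if pselect (exists n, x n != 0) is left x_neq0 then 2 ^- ex_minn x_neq0
  else 0.

Definition Z2_dist (x y : Z2) : R := Z2_abs (x - y).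

Lemma Z2_abs_spec (x : Z2) :
  (x = 0 /\ Z2_abs x = 0) \/
  exists n, [/\ Z2_abs x = 2 ^- n, x n != 0 & forall i, (i < n)%N -> x i = 0].
Proof.
rewrite /Z2_abs; case: pselect => [e|ne]; last first.
  left; split=> //; apply: Z2P => n; apply/eqP/negPn/negP => xn.
  by apply: ne; exists n.
right; case: ex_minnP => n xn nmin; exists n; split=> // i ltin.
by apply/eqP; apply: contraTT ltin => /nmin; rewrite -leqNgt.
Qed.

Lemma Z2_abs0 : Z2_abs 0 = 0.
Proof. by have [[]//|[n [_ /eqP]]] := Z2_abs_spec 0. Qed.

Lemma Z2_abs_ge0 x : 0 <= Z2_abs x.
Proof.
by have [[_ ->]//|[n [-> _ _]]] := Z2_abs_spec x; rewrite invr_ge0 exprn_ge0.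
Qed.

Lemma Z2_abs_eq0 x : Z2_abs x = 0 -> x = 0.
Proof.
have [[]//|[n [-> _ _]]] := Z2_abs_spec x.
by move=> /eqP; rewrite invr_eq0 expf_eq0 pnatr_eq0 andbF.
Qed.

Lemma Z2_abs_le (x : Z2) n : (forall i, (i < n)%N -> x i = 0) -> Z2_abs x <= 2 ^- n.
Proof.
move=> x0; have [[_ ->]|[k [-> xk _]]] := Z2_abs_spec x.
  by rewrite invr_ge0 exprn_ge0.
rewrite lef_pV2 ?posrE ?exprn_gt0// ler_eXn2l ?ltr1n// leqNgt.
by apply: contra xk => /x0 ->.
Qed.

Lemma Z2_absN x : Z2_abs (- x) = Z2_abs x.
Proof.
suff le y : Z2_abs (- y) <= Z2_abs y.
  by apply/eqP; rewrite eq_le le -{1}(opprK x) le.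
have [[-> _]|[n [-> _ y0]]] := Z2_abs_spec y; first by rewrite oppr0.
by apply: Z2_abs_le => i /y0 /= ->; rewrite oppr0.
Qed.

Lemma Z2_absD x y : Z2_abs (x + y) <= Num.max (Z2_abs x) (Z2_abs y).
Proof.
have [[-> ->]|[a [xE _ x0]]] := Z2_abs_spec x.
  by rewrite add0r le_max lexx orbT.
have [[-> ->]|[b [yE _ y0]]] := Z2_abs_spec y.
  by rewrite addr0 le_max lexx.
wlog leab : a b x y xE x0 yE y0 / (a <= b)%N.
  move=> W; case: (leqP a b) => [|/ltnW] le; first exact: (W a b).
  by rewrite addrC maxC; apply: (W b a).
apply: (@le_trans _ _ (2 ^- a)); last by rewrite le_max xE lexx.
apply: Z2_abs_le => i ltia /=.
by rewrite x0// y0 ?addr0// (leq_trans ltia).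
Qed.

Fact Z2_distxx x : Z2_dist x x = 0.
Proof. by rewrite /Z2_dist subrr Z2_abs0. Qed.
Fact Z2_dist_eq0 x y : Z2_dist x y = 0 -> x = y.
Proof. by move/Z2_abs_eq0/eqP; rewrite subr_eq0 => /eqP. Qed.
Fact Z2_dist_sym x y : Z2_dist x y = Z2_dist y x.
Proof. by rewrite /Z2_dist -Z2_absN opprB. Qed.
Fact Z2_dist_triangle y x z : Z2_dist x z <= Z2_dist x y + Z2_dist y z.
Proof.
have -> : Z2_dist x z = Z2_abs ((x - y) + (y - z)).
  by rewrite addrA subrK.
apply: le_trans (Z2_absD _ _) _.
by rewrite ge_max lerDl lerDr !Z2_abs_ge0.
Qed.

HB.instance Definition _ := isMetric.Build R Z2
  Z2_distxx Z2_dist_eq0 Z2_dist_sym Z2_dist_triangle.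

Fixpoint fibonacci_poly (A : nzRingType) (m : nat) : {poly A} :=
  match m with
  | 0 => 0
  | 1 => 1
  | (m''.+1 as m').+1 => 'X * fibonacci_poly A m' + fibonacci_poly A m''
  end.

Section MinimalDecomposition.
Context {K : realType} {T : metricType K}.
Implicit Types (f : T -> T) (x : T) (C P M B : set T).

Definition forward_orbit f x : set T := range (fun n => iter n f x).

Definition periodic_points f : set T :=
  [set x | exists2 n, (0 < n)%N & iter n f x = x].

Definition finite_union_of_balls C : Prop :=
  exists2 s : seq (T * K), (forall c, c \in s -> 0 < c.2) &
    C = \bigcup_(c in [set` s]) ball c.1 c.2.

(* The nonemptiness condition excludes [set0], for which the other conditions
   hold vacuously. *)
Definition minimal_components f : set (set T) :=
  [set C | [/\ C !=set0, clopen C, finite_union_of_balls C, f @` C `<=` C &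
             forall x, C x -> C `<=` closure (forward_orbit f x)]].

(* [edist_inf C y] is the distance from [y] to the set [C]. *)
Definition basin f C : set T :=
  [set x | edist_inf C (iter n f x) @[n --> \oo] --> 0%E].

Definition minimal_decomposition f P M B : Prop :=
  [/\ P `|` M `|` B = setT,
      [/\ P `&` M = set0, P `&` B = set0 & M `&` B = set0],
      finite_set P /\ P = periodic_points f,
      [/\ countable (minimal_components f), trivIset (minimal_components f) id &
          M = \bigcup_(C in minimal_components f) C] &
      forall x, B x ->
        (exists2 p, periodic_points f p & basin f (forward_orbit f p) x) \/
        (exists2 C, minimal_components f C & basin f C x)].

End MinimalDecomposition.

(* Main.v *)
Require Import Defs.
From mathcomp Require Import all_boot all_order all_algebra.
From mathcomp Require Import all_classical all_reals all_analysis.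
From mathcomp Require Import Rstruct ring.

(** For odd m, the polynomial F_m is even, hence a polynomial in x^2, and
    x^2 - y^2 = (x - y)(x + y) gains a factor 2 over x - y as soon as x and y
    have the same parity.  So F_m at least halves the distance between points of the
    same residue class modulo 2 ([fibonacci_contracting]); in terms of
    residues, a congruence modulo 2^n with n > 0 becomes a congruence modulo
    2^(n+1).

    It remains to see how F_m moves the two parity classes.  Modulo 2, F_m(0)
    is 1 (m is odd), and F_m(1) is the Fibonacci number, which is even exactly
    when 3 divides m.  If 3 does not divide m, everything is mapped into the
    odd class, on which F_m is a contraction: its fixed point attracts all
    points.  If 3 divides m, the two classes are exchanged; the contraction
    F_m \o F_m has a fixed point a in the even class, and the 2-cycle {a, F_m a}
    meets both classes, so each orbit shadows one of its two phases.

    The rest is common to both cases ([contracting_decomposition]): let C be a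
    finite invariant set of periodic points such that the image of every point
    has the parity of the image of a point of C.  Shadowing puts every point
    in the basin of C.  Two periodic points that shadow each other are equal
    ([periodic_inj]), so C contains all periodic points.  A minimal component
    M would be closed, hence contain some c in C, and by minimality would lie
    in the finite set C; but M is open and Z_2 has no isolated point
    ([no_isolated_point]). *)

Import Order.TTheory GRing.Theory Num.Theory.

Local Open Scope classical_set_scope.
Local Open Scope ring_scope.

(** * Residues, balls and the metric of Z_2 *)
Lemma residueD (x y : Z2) n : (x + y) n = x n + y n.
Proof. by []. Qed.

Lemma residueM (x y : Z2) n : (x * y) n = x n * y n.
Proof. by []. Qed.

Lemma residue_le {x y : Z2} {k n : nat} : (k <= n)%N -> x n = y n -> x k = y k.
Proof.
move=> /subnK <-; elim: (n - k)%N => [|j IH] // xy.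
by apply: IH; rewrite (residueE x) (residueE y) [in LHS]xy.
Qed.

Lemma Z2_dist_residue {x y : Z2} {n : nat} : x n = y n -> Z2_dist x y < 2 ^- n.
Proof.
move=> xy; apply: (@le_lt_trans _ _ (2 ^- n.+1)); last first.
  by rewrite ltf_pV2 ?posrE ?exprn_gt0// ltr_eXn2l ?ltr1n.
apply: Z2_abs_le => i lein.
have -> : (x - y) i = x i - y i by [].
by rewrite (@residue_le x y i n lein xy) subrr.
Qed.

Lemma nbhs_residue (x : Z2) (B : set Z2) :
  nbhs x B -> exists n, forall y : Z2, x n = y n -> B y.
Proof.
move=> /nbhs_ballP[e /= e_gt0 ballB].
have := near_infty_natSinv_expn_lt (PosNum e_gt0) =>
    -[N _ /(_ N (leqnn N))] /= le_e.
exists N => y xy; apply: ballB; rewrite ballEmdist /=.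
by apply: lt_trans (Z2_dist_residue xy) _; rewrite -div1r.
Qed.

Lemma residue0_cases (x : Z2) : x 0%N = 0 \/ x 0%N = 1.
Proof.
case: (x 0%N) => -[|[|k]] lt_k; [left|right|by []]; exact: val_inj.
Qed.

(** * Maps contracting each parity class *)

(** Since [x n] is the residue modulo 2^(n+1), the weakest hypothesis, at
    [n = 0], is that x and y have the same parity: points of different parity
    are not constrained, so f may exchange the two classes. *)
Definition residue_contracting (f : Z2 -> Z2) : Prop :=
  forall n (x y : Z2), x n = y n -> f x n.+1 = f y n.+1.

Lemma contracting_iter {f} : residue_contracting f ->
  forall (x y : Z2) n, x 0%N = y 0%N -> iter n f x n = iter n f y n.
Proof. by move=> fC x y n xy; elim: n => [|n IH] //=; apply: fC. Qed.

Lemma contracting_comp {f g} :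
  residue_contracting f -> residue_contracting g -> residue_contracting (f \o g).
Proof. by move=> fC gC n x y /gC /(residue_le (leqnSn n)) /fC. Qed.

(** Banach's fixed point theorem on the parity class of x, which f preserves.
    The n-th residue of the n-th iterate is already final, so the limit is the
    diagonal sequence of residues and needs no completeness argument. *)
Lemma contracting_fixed {f} {x : Z2} : residue_contracting f ->
  f x 0%N = x 0%N -> exists2 a : Z2, f a = a & a 0%N = x 0%N.
Proof.
move=> fC fx.
have coh : coherent (fun n => iter n f x n).
  (* The orbits of x and of f x agree to level n after n steps. *)
  apply/asboolP => n; rewrite -residueE iterSr.
  by apply: contracting_iter => //; rewrite fx.
exists (MkZ2 coh) => //; apply: Z2P => n.
have /(residue_le (leqnSn n)) -> :
    f (MkZ2 coh) n.+1 = iter n.+1 f x n.+1 by apply: fC.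
by rewrite iterSr; apply: contracting_iter.
Qed.

(** Iterating a common multiple of the two periods brings both points back
    while making them arbitrarily close. *)
Lemma periodic_inj {f} {x y : Z2} : residue_contracting f ->
  periodic_points f x -> periodic_points f y -> f x 0%N = f y 0%N -> x = y.
Proof.
move=> fC [p p_gt0 px] [q q_gt0 qy] fxy; apply: Z2P => n.
(* A common multiple of the periods that exceeds the level n. *)
pose N := (n.+1 * (q * p))%N.
have <- : iter N f x = x by rewrite /N mulnA iterM iter_fix.
have <- : iter N f y = y by rewrite /N (mulnC q) mulnA iterM iter_fix.
have lt_nN : (n < N)%N by rewrite /N leq_pmulr // muln_gt0 q_gt0.
case: N lt_nN => // N /ltnSE le_nN; rewrite !iterSr.
exact: residue_le le_nN (contracting_iter fC _ _ _ fxy).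
Qed.

(** The orbit of x shadows that of c, one step late: only the images of x and c
    are assumed congruent, so that a point outside the class of the attracting
    cycle is covered. *)
Lemma basin_contracting {f} {x c : Z2} {D : set Z2} : residue_contracting f ->
  f x 0%N = f c 0%N -> forward_orbit f c `<=` D -> basin f D x.
Proof.
move=> fC fxc cD; rewrite /basin /=.
suff : edist_inf D (iter n.+1 f x) @[n --> \oo] --> 0%E.
  by rewrite (cvg_shiftS (fun n => edist_inf D (iter n f x))).
apply: (squeeze_cvge (f := cst 0%E) (h := fun n => (2^-1 ^+ n)%:E)).
- apply: nearW => n; rewrite edist_inf_ge0 /=.
  apply: (@le_trans _ _ (edist (iter n.+1 f x, iter n.+1 f c))).
    by apply: ereal_inf_lbound; exists (iter n.+1 f c) => //; apply: cD; exists n.+1.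
  apply: edist_fin; first by rewrite exprn_gt0 // invr_gt0.
  rewrite exprVn !iterSr ballEmdist; apply: Z2_dist_residue.
  exact: contracting_iter.
- exact: cvg_cst.
- apply: cvg_EFin; first exact: nearW.
  by apply: cvg_expr; rewrite ger0_norm ?invr_ge0 // invf_lt1 // ltr1n.
Qed.

Lemma no_isolated_point {M : set Z2} {c : Z2} :
  open M -> M c -> exists2 z, M z & z != c /\ z 0%N = c 0%N.
Proof.
move=> oM Mc; have /nbhs_residue[n nM] : nbhs c M by apply: open_nbhs_nbhs.
(* The translate of c by a power of 2 that vanishes at level n but not at
   level n.+1. *)
have lt2 : (2 ^ n.+1 < 2 ^ n.+2)%N by rewrite ltn_exp2l.
pose d : Z2 := (2 ^ n.+1)%:R.
have dE k : d k = (2 ^ n.+1)%:R.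
  by rewrite /d; elim: (2 ^ n.+1)%N => [|j IH] //; rewrite !mulrS residueD IH.
have agree : c n = (c + d) n.
  rewrite residueD dE.
  by rewrite -[(_ ^ _)%:R](Zp_nat_mod (gt1_exp2S n)) modnn addr0.
exists (c + d); first exact: nM.
split; last by rewrite (residue_le (leq0n n) agree).
rewrite -subr_eq0 addrC addKr; apply/eqP => /(congr1 (fun u : Z2 => u n.+1 : nat)).
rewrite dE val_Zp_nat ?gt1_exp2S // modn_small //.
by move/eqP; rewrite expn_eq0.
Qed.

(** A minimal component would be an open set made of periodic points, while
    periodic points are separated by the parity of their images. *)
Lemma contracting_no_component {f} {C : set Z2} : residue_contracting f ->
  finite_set C -> C `<=` periodic_points f -> f @` C `<=` C ->
  (forall x, exists2 c, C c & f x 0%N = f c 0%N) ->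
  minimal_components f = set0.
Proof.
move=> fC Cfin Cper Cinv Cmeet; apply/seteqP; split=> // M.
move=> [[x Mx] [oM cM] _ Minv Mdense].
have Miter n : M (iter n f x).
  by elim: n => [|n IH] //=; apply: Minv; exists (iter n f x).
have [c Cc fxc] := Cmeet x.
have Citer n : C (iter n f c).
  by elim: n => [|n IH] //=; apply: Cinv; exists (iter n f c).
(* The iterates of x at multiples of the period of c tend to c. *)
have Mc : M c.
  apply: cM => B /nbhs_residue[n nB].
  have [p p_gt0 pc] := Cper _ Cc; pose N := (n.+1 * p)%N.
  exists (iter N f x); split; first exact: Miter.
  apply: nB; have {1}<- : iter N f c = c by rewrite iterM iter_fix.
  have lt_nN : (n < N)%N by rewrite leq_pmulr.
  case: N lt_nN => // N /ltnSE le_nN; rewrite !iterSr.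
  exact: residue_le le_nN (contracting_iter fC _ _ _ (esym fxc)).
have MC : M `<=` C.
  have /accessible_finite_set_closed /(_ C Cfin) /closure_id -> : accessible_space Z2.
    exact/hausdorff_accessible/metric_hausdorff.
  apply: subset_trans (Mdense c Mc) (closureS _).
  by move=> _ [n _ <-].
have [z Mz [/eqP z_neq zc]] := no_isolated_point oM Mc.
apply: z_neq; apply: (periodic_inj fC); [exact/Cper/MC|exact: Cper|].
exact: (residue_le (leq0n 1) (fC _ _ _ zc)).
Qed.

Lemma contracting_decomposition {f} {C : set Z2} : residue_contracting f ->
  finite_set C -> C `<=` periodic_points f -> f @` C `<=` C ->
  (forall x, exists2 c, C c & f x 0%N = f c 0%N) ->
  minimal_decomposition f C set0 (~` C) /\ ~` C `<=` basin f C.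
Proof.
move=> fC Cfin Cper Cinv Cmeet.
have noM := contracting_no_component fC Cfin Cper Cinv Cmeet.
split; last first.
  move=> x _; have [c Cc fxc] := Cmeet x.
  apply: (basin_contracting fC fxc) => _ [n _ <-].
  by elim: n => [|n IH] //=; apply: Cinv; exists (iter n f c).
split.
- by rewrite setU0 setUv.
- by rewrite setI0 setICr set0I.
- split=> //; apply/seteqP; split=> // x xper.
  have [c Cc fxc] := Cmeet x.
  by rewrite (periodic_inj fC xper (Cper _ Cc) fxc).
- by rewrite noM; split; [exact: countable0|by move=> ? ? []|rewrite bigcup_set0].
- move=> x _; left; have [c Cc fxc] := Cmeet x.
  by exists c; [exact: Cper|exact: (basin_contracting fC fxc)].
Qed.

(** * Fibonacci polynomials *)

(** With u = v + k 2^(n+1), the cross term 2 v k 2^(n+1) of u^2 supplies the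
    extra factor 2, and the last term k^2 2^(2n+2) is divisible by 2^(n+2). *)
Lemma residue_sqr {n : nat} {x y : Z2} :
  x n = y n -> (x * x) n.+1 = (y * y) n.+1.
Proof.
move=> xy; rewrite !residueM -[x n.+1]natr_Zp -[y n.+1]natr_Zp -!natrM.
have : (x n.+1 = y n.+1 %[mod 2 ^ n.+1])%N.
  by rewrite -!val_Zp_nat ?gt1_exp2S // -!residueE xy.
move: (x n.+1 : nat) (y n.+1 : nat) => u v uv.
rewrite -(Zp_nat_mod (gt1_exp2S n.+1)) -[RHS](Zp_nat_mod (gt1_exp2S n.+1)).
congr (_%:R); wlog le_vu : u v uv / (v <= u)%N.
  by case: (leqP v u) => [|/ltnW] le W; [|apply/esym]; apply: W.
have /dvdnP[k uE] : (2 ^ n.+1 %| u - v)%N by rewrite -eqn_mod_dvd //; apply/eqP.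
rewrite -(subnKC le_vu) {}uE.
have -> : ((v + k * 2 ^ n.+1) * (v + k * 2 ^ n.+1) =
           (k * v + k * k * 2 ^ n) * 2 ^ n.+2 + v * v)%N.
  by rewrite !expnS; ring.
by rewrite modnMDl.
Qed.

Lemma fibonacci_hornerSS (A : comNzRingType) (x : A) m :
  (fibonacci_poly A m.+2).[x] =
  x * (fibonacci_poly A m.+1).[x] + (fibonacci_poly A m).[x].
Proof. by rewrite /= hornerD hornerM hornerX. Qed.

(** For odd k, F_k is a polynomial in x^2, and so is x F_k for even k.  The
    proof follows this parity through the recurrence, working directly on
    congruences. *)
Lemma fibonacci_contracting m : odd m ->
  residue_contracting (fun x => (fibonacci_poly Z2 m).[x]).
Proof.
move=> m_odd n x y /residue_sqr sq.
rewrite -(odd_double_half m) m_odd add1n.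
pose F (z : Z2) k := (fibonacci_poly Z2 k).[z].
suff [] : F x (m./2).*2.+1 n.+1 = F y (m./2).*2.+1 n.+1 /\
  (x * F x (m./2).*2) n.+1 = (y * F y (m./2).*2) n.+1 by [].
elim: (m./2) => [|k [IHodd IHeven]].
  by rewrite /F /= !hornerE.
have even : (x * F x k.+1.*2) n.+1 = (y * F y k.+1.*2) n.+1.
  rewrite doubleS /F !fibonacci_hornerSS !mulrDr !mulrA.
  by rewrite !residueD IHeven ![in LHS]residueM IHodd -residueM sq.
split=> //.
by rewrite /F doubleS !(fibonacci_hornerSS _ _ _.*2.+1) !residueD even IHodd.
Qed.

Lemma fibonacci_residue0 (x : Z2) m : x 0%N = 0 ->
  (fibonacci_poly Z2 m).[x] 0%N = (odd m)%:R.
Proof.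
move=> x0; suff [] : (fibonacci_poly Z2 m).[x] 0%N = (odd m)%:R /\
  (fibonacci_poly Z2 m.+1).[x] 0%N = (odd m.+1)%:R by [].
elim: m => [|m [IH IHS]]; first by rewrite /= !hornerE.
split=> //.
by rewrite fibonacci_hornerSS residueD residueM x0 mul0r add0r IH /= negbK.
Qed.

(** The parity of the Fibonacci numbers has period 3. *)
Lemma fibonacci_residue1 (x : Z2) m : x 0%N = 1 ->
  (fibonacci_poly Z2 m).[x] 0%N = (m %% 3 != 0)%N%:R.
Proof.
move=> x1; rewrite {1}(divn_eq m 3).
have two : 2 = 0 :> 'Z_(2 ^ 1) by apply: val_inj.
elim: (m %/ 3)%N => [|k IH].
  rewrite mul0n add0n.
  case: (m %% 3)%N (ltn_pmod m (isT : 0 < 3)%N) => [|[|[|]]] // _.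
  - by rewrite /= horner0.
  - by rewrite /= hornerC.
  - by rewrite fibonacci_hornerSS residueD residueM x1 /= hornerC horner0 addr0 mulr1.
rewrite mulSn -addnA; move: (_ + _)%N IH => j IH.
rewrite -IH !add3n fibonacci_hornerSS fibonacci_hornerSS.
rewrite !(residueD, residueM) x1 !mul1r addrAC.
by rewrite -mulr2n -mulr_natl two mul0r add0r.
Qed.

Theorem theorem3p1 (m : nat) (m_odd : odd m) :
  let F : Z2 -> Z2 := fun x => (fibonacci_poly Z2 m).[x] in
  ((m %% 3 = 1 \/ m %% 3 = 2)%N ->
     exists a : Z2,
       [/\ F a = a,
           minimal_decomposition F [set a] set0 (~` [set a]) &
           ~` [set a] `<=` basin F [set a]]) /\
  ((m %% 3 = 0)%N ->
     exists a b : Z2,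
       [/\ [/\ a != b, F a = b & F b = a],
           minimal_decomposition F [set a; b] set0 (~` [set a; b]) &
           ~` [set a; b] `<=` basin F [set a; b]]).
Proof.
move=> F; have FC : residue_contracting F := fibonacci_contracting m m_odd.
have F0 (x : Z2) : x 0%N = 0 -> F x 0%N = 1.
  by move=> x0; rewrite fibonacci_residue0 // m_odd.
split=> m3.
  have Fodd (x : Z2) : F x 0%N = 1.
    have [/F0 //|x1] := residue0_cases x.
    by rewrite fibonacci_residue1 //; case: m3 => ->.
  have [a Fa _] := contracting_fixed (x := 1) FC (Fodd 1).
  exists a.
  suff [] : minimal_decomposition F [set a] set0 (~` [set a]) /\
    ~` [set a] `<=` basin F [set a] by [].
  apply: contracting_decomposition => //.
  - by move=> _ ->; exists 1%N.
  - by move=> _ [_ -> <-].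
  - by move=> x; exists a; rewrite // !Fodd.
have F1 (x : Z2) : x 0%N = 1 -> F x 0%N = 0.
  by move=> x1; rewrite fibonacci_residue1 // m3.
have FF0 : (F \o F) 0 0%N = (0 : Z2) 0%N by apply: F1; apply: F0.
have [a FFa a0] := contracting_fixed (contracting_comp FC FC) FF0.
exists a, (F a).
suff [] : minimal_decomposition F [set a; F a] set0 (~` [set a; F a]) /\
    ~` [set a; F a] `<=` basin F [set a; F a].
  split=> //; split=> //; apply/eqP => aFa.
  by have := F0 a a0; rewrite -aFa a0.
apply: contracting_decomposition => //.
- by move=> _ [->|->]; exists 2%N; rewrite //= -[F (F a)]/((F \o F) a) FFa.
- by move=> _ [_ [->|->] <-]; [right|left].
- move=> x; have [x0|x1] := residue0_cases x.
    by exists a; [left|rewrite !F0].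
  by exists (F a); [right|rewrite (F1 x x1) (F1 _ (F0 a a0))].
Qed.
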